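(* For each initial condition $q\in Q$ there exists at most one fluid trajectory $\boldsymbol{q}:[0,\infty)\to Q$ with $\boldsymbol{q}(0)=q$.
   Context: Let $\mathbb{N}=\{0,1,2,\dots\}$ and $m\geq 1$. For $i=1,\dots,m$ let $u_i:[0,\infty)\to\mathbb{R}$ be a concave function (only its values on $\mathbb{N}$ matter) and $\Delta(i,j)=u_i(j+1)-u_i(j)$ for $j\in\mathbb{N}$. Let $\mathcal{I}=\{1,\dots,m\}\times\mathbb{N}$ and $\mathcal{I}_+=\{(i,j)\in\mathcal{I}:j\geq 1\}$. Define a total order $\vartriangleleft$ on $\mathcal{I}_+$ by: $(i,j)\vartriangleleft(i',j')$ iff either $\Delta(i,j-1)<\Delta(i',j'-1)$, or $\Delta(i,j-1)=\Delta(i',j'-1)$ and $(i,j)$ is strictly larger than $(i',j')$ in the lexicographic order. Write $\vartriangleright$ for the reverse order. Every nonempty subset of $\mathcal{I}_+$ has a largest element for $\vartriangleleft$. Let $\lambda,\mu>0$ and let $\alpha(i)\in(0,1)$, $i=1,\dots,m$, with $\sum_i\alpha(i)=1$. $\ell_1$ is the space of absolutely summable elements of $\mathbb{R}^{\mathcal{I}}$, and $Q=\{q\in[0,1]^{\mathcal{I}}\cap\ell_1: q(i,j+1)\leq q(i,j)\leq q(i,0)=\alpha(i)\text{ for all }(i,j)\in\mathcal{I}\}$. For $q\in Q$ let $\sigma(q)=\max\{(i,j)\in\mathcal{I}_+:q(i,j-1)>q(i,j)\}$, the maximum being with respect to $\vartriangleleft$. Define $\Lambda:Q\times\mathcal{I}_+\to\mathbb{R}$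 by $\Lambda(q,i,j)=0$ if $(i,j)\vartriangleleft\sigma(q)$; $\Lambda(q,i,j)=\mu j[\alpha(i)-q(i,j+1)]$ if $(i,j)\vartriangleright\sigma(q)$; and $\Lambda(q,i,j)=\lambda-\sum_{(k,l)\vartriangleright\sigma(q)}\mu l[\alpha(k)-q(k,l+1)]$ if $(i,j)=\sigma(q)$. A function $\boldsymbol{q}:[0,\infty)\to Q$ is a fluid trajectory if all coordinate functions $\boldsymbol{q}(i,j)$ are absolutely continuous (on bounded intervals) and, for almost every $t$ with respect to Lebesgue measure, $\dot{\boldsymbol{q}}(i,j)=\Lambda(\boldsymbol{q},i,j)-\mu j[\boldsymbol{q}(i,j)-\boldsymbol{q}(i,j+1)]$ and $\Lambda(\boldsymbol{q},i,j)\geq 0$ for all $(i,j)\in\mathcal{I}_+$. *)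

(* Defs.v *)
From mathcomp Require Import all_boot all_order all_algebra.
From mathcomp Require Import all_classical all_reals all_analysis.

Set Implicit Arguments.
Unset Strict Implicit.
Unset Printing Implicit Defensive.

Import Order.TTheory GRing.Theory Num.Theory.
Import numFieldNormedType.Exports.

Local Open Scope classical_set_scope.
Local Open Scope ring_scope.

Definition concave_on (R : realType) (D : set R) (f : R -> R) : Prop :=
  @convex_function R R^o D (fun x => - f x).

Definition absolutely_continuous_on (R : realType) (c d : R) (f : R -> R) : Prop :=
  forall eps : R, 0 < eps -> exists2 delta : R, 0 < delta &
    forall (n : nat) (a b : 'I_n -> R),
      (forall k, c <= a k /\ a k <= b k /\ b k <= d) ->
      trivIset setT (fun k => `]a k, b k[%classic) ->
      \sum_(k < n) (b k - a k) < delta ->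
      \sum_(k < n) `|f (b k) - f (a k)| < eps.

(* The classes {1, ..., m} with m >= 1 are represented by 'I_m.+1, so that the
   successor accounts for m >= 1 and the classes are numbered from 0. *)
Notation state_index m := ('I_m.+1 * nat)%type (only parsing).

Definition index_pos (m : nat) : set (state_index m) := [set x | (1 <= x.2)%N].

Section FluidModel.
Context (R : realType) (m : nat).
Context (u : 'I_m.+1 -> R -> R) (lambda mu : R) (alpha : 'I_m.+1 -> R).

Definition Delta (i : 'I_m.+1) (j : nat) : R := u i j.+1%:R - u i j%:R.

(* Only meaningful on index_pos, because of the predecessors. Ties are broken
   by the reverse of the lexicographic order: the lexicographically larger pair
   is the smaller one for prec. *)
Definition prec (x y : state_index m) : bool :=
  (Delta x.1 x.2.-1 < Delta y.1 y.2.-1) ||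
  ((Delta x.1 x.2.-1 == Delta y.1 y.2.-1) &&
   ((y : 'I_m.+1 *l nat) < (x : 'I_m.+1 *l nat))%O).

Definition Qset : set (state_index m -> R) :=
  [set q | [/\ forall x, 0 <= q x <= 1,
               summable setT (fun x => (q x)%:E) &
               forall i j, [/\ q (i, j.+1) <= q (i, j),
                               q (i, j) <= q (i, 0%N) &
                               q (i, 0%N) = alpha i]]].

Definition is_maximum (A : set (state_index m)) (x : state_index m) : Prop :=
  A x /\ forall y, A y -> y <> x -> prec y x.

(* The default value (ord0, 1) is irrelevant: for q in Qset with alpha > 0 the
   set is nonempty, hence has a maximum when the u i are concave. *)
Definition sigma (q : state_index m -> R) : state_index m :=
  xget (ord0, 1%N)
    (is_maximum [set x | index_pos x /\ q (x.1, x.2.-1) > q x]).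

(* The sum is over a finite set when q is in Qset: q (k, l) = alpha k > 0
   whenever (k, l) is above sigma q (the u i being concave), and q is
   summable. *)
Definition Lambda (q : state_index m -> R) (x : state_index m) : R :=
  if x == sigma q then
    lambda - \sum_(y \in [set y | index_pos y /\ prec (sigma q) y])
               mu * y.2%:R * (alpha y.1 - q (y.1, y.2.+1))
  else if prec x (sigma q) then 0
  else mu * x.2%:R * (alpha x.1 - q (x.1, x.2.+1)).

(* A function [0, oo) -> Qset is a function on R whose values at negative times
   are ignored; accordingly the equations are required at almost every t > 0,
   where the derivative only depends on the values at positive times. *)
Definition fluid_trajectory (q : R -> state_index m -> R) : Prop :=
  [/\ forall t, 0 <= t -> Qset (q t),
      forall x (T : R), 0 < T -> absolutely_continuous_on 0 T (q ^~ x) &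
      {ae (@lebesgue_measure R), forall t : R, 0 < t ->
        forall x, index_pos x ->
          is_derive t 1 (q ^~ x)
            (Lambda (q t) x - mu * x.2%:R * (q t x - q t (x.1, x.2.+1))) /\
          0 <= Lambda (q t) x}].

End FluidModel.

(* Main.v *)
(* The distance between two trajectories is an l1 contraction. Let D be their
   difference. Both receive arrivals at total rate lambda. The trajectory whose
   maximum sigma is larger has D of the favourable sign at sigma, where the other
   one is full, and receives nothing below; above sigma both are full. Hence the
   arrivals never increase the sum of |D| over {j <= n}, once n exceeds the levels
   that can be full. What remains is the flux into level n, so this sum grows at
   rate at most mu n sum_i |D (i, n + 1)|. Adding these sums over n with weights
   1/n makes the fluxes add up to at most mu |D|_1, which is bounded on bounded
   times, whereas the weights have a divergent sum; hence D = 0. *)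
Require Import Defs.
From mathcomp Require Import all_boot all_order all_algebra.
From mathcomp Require Import all_classical all_reals all_analysis.
From mathcomp Require Import ring lra.

Set Implicit Arguments.
Unset Strict Implicit.
Unset Printing Implicit Defensive.

Import Order.TTheory GRing.Theory Num.Theory.
Import numFieldNormedType.Exports.

Local Open Scope classical_set_scope.
Local Open Scope ring_scope.

(** * Cousin's lemma and upper bounds on slopes *)

(** Compactness by a supremum argument. The set of [s] with [P a s] contains its supremum, because a
    short interval ending there can be appended. A short interval starting there then goes beyond
    it, unless it equals [b]. *)
Lemma cousin (R : realType) (P : R -> R -> Prop) (a b : R) :
  (forall x y z, a <= x -> x <= y -> y <= z -> z <= b ->
     P x y -> P y z -> P x z) ->
  (forall t, a <= t <= b -> exists2 d, 0 < d &
     forall x y, a <= x -> y <= b -> t - d < x -> x <= t -> t <= y -> y < t + d ->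
     P x y) ->
  a <= b -> P a b.
Proof.
move=> Ptr Ploc ab.
pose S := [set s | a <= s <= b /\ P a s].
have Sa : S a.
  split; first by rewrite lexx.
  have [|d d0 dP] := Ploc a; first by rewrite lexx.
  by apply: dP => //; lra.
have ubS : has_ubound S by exists b => s [/andP[]].
have supS : has_sup S by split; [exists a|].
have aS : a <= sup S by exact: ub_le_sup.
have Sb : sup S <= b by apply: ge_sup; [exists a|move=> s [/andP[]]].
have [|d d0 dP] := Ploc (sup S); first exact/andP.
have [s [/andP[as_ sb] Pas] sS] := sup_adherent d0 supS.
have sle : s <= sup S by apply: ub_le_sup => //; split => //; apply/andP.
have PaS : P a (sup S) by apply: (Ptr _ s) => //; apply: dP => //; lra.
(* Strictly beyond the supremum if the latter is less than [b], and still within reach of the local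
   hypothesis. *)
pose y := Num.min b (sup S + d / 2).
have yb : y <= b by rewrite ge_min lexx.
have Sy : sup S <= y by rewrite le_min Sb /=; lra.
have yd : y < sup S + d by rewrite gt_min; apply/orP; right; lra.
have Pay : P a y by apply: (Ptr _ (sup S)) => //; apply: dP => //; lra.
have : y <= sup S by apply: ub_le_sup => //; split => //; apply/andP; split => //; lra.
rewrite ge_min => /orP[bS|]; last by lra.
by have <- : sup S = b by apply/eqP; rewrite eq_le Sb bS.
Qed.

(** A one-sided substitute for the derivative, which [|f|] satisfies even at a zero of [f]. The
    intervals contain [t], to match the local hypothesis of [cousin]. *)
Definition straddle_le (R : realType) (f : R -> R) (t c : R) : Prop :=
  forall eps, 0 < eps -> exists2 d, 0 < d &
    forall a b, t - d < a -> a <= t -> t <= b -> b < t + d ->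
    f b - f a <= (c + eps) * (b - a).

Section Straddle.
Context {R : realType}.
Implicit Types (f g : R -> R) (t c d : R).

Lemma straddle_le_ext f g t c : f =1 g -> straddle_le f t c -> straddle_le g t c.
Proof. by move=> /funext ->. Qed.

Lemma straddle_le_weak f t c d : c <= d -> straddle_le f t c -> straddle_le f t d.
Proof.
move=> cd fc eps eps0; have [e e0 fe] := fc _ eps0; exists e => // a b ta at_ tb bt.
apply: (le_trans (fe a b ta at_ tb bt)); apply: ler_wpM2r; last by rewrite lerD2r.
by rewrite subr_ge0 (le_trans at_).
Qed.

Lemma straddle_le_cst t k : straddle_le (fun=> k) t 0.
Proof.
by move=> eps e0; exists 1 => // a b *; rewrite subrr add0r mulr_ge0 ?(ltW e0)//; lra.
Qed.

Lemma straddle_leD f g t c d :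
  straddle_le f t c -> straddle_le g t d -> straddle_le (fun s => f s + g s) t (c + d).
Proof.
move=> fc gd eps eps0; have e2 : 0 < eps / 2 by lra.
have [e1 e10 h1] := fc _ e2; have [e3 e30 h3] := gd _ e2.
exists (Num.min e1 e3); first by rewrite lt_min e10.
move=> a b; rewrite ltrBlDr -ltrBlDl lt_min -ltrBlDl lt_min.
move=> /andP[? ?] ? ? /andP[? ?].
have := h1 a b; have := h3 a b.
move=> H3 H1.
have {}H1 : f b - f a <= (c + eps / 2) * (b - a) by apply: H1; lra.
have {}H3 : g b - g a <= (d + eps / 2) * (b - a) by apply: H3; lra.
lra.
Qed.

Lemma straddle_leZ k f t c :
  0 <= k -> straddle_le f t c -> straddle_le (fun s => k * f s) t (k * c).
Proof.
rewrite le_eqVlt => /predU1P[<-|k0] fc eps eps0.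
  have [d d0 fd] := straddle_le_cst t 0 eps0; exists d => // a b *.
  by rewrite !mul0r; exact: fd.
have [e e0 fe] := fc (eps / k) (divr_gt0 eps0 k0); exists e => // a b *.
rewrite -mulrBr (_ : k * c + eps = k * (c + eps / k)).
  by rewrite -mulrA ler_pM2l//; exact: fe.
by rewrite mulrDr mulrCA divff ?mulr1// gt_eqF.
Qed.

Lemma straddle_le_sum (I : Type) (r : seq I) (P : pred I) (f : I -> R -> R) (c : I -> R) t :
  (forall i, P i -> straddle_le (f i) t (c i)) ->
  straddle_le (fun s => \sum_(i <- r | P i) f i s) t (\sum_(i <- r | P i) c i).
Proof.
move=> fc; elim: r => [|i r IH].
  apply: (straddle_le_ext (f := fun=> 0)) => [s|]; first by rewrite big_nil.
  by rewrite big_nil; exact: straddle_le_cst.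
rewrite big_cons; case: ifPn => Pi.
  apply: (straddle_le_ext (f := fun s => f i s + \sum_(i <- r | P i) f i s)) => [s|].
    by rewrite big_cons Pi.
  exact: straddle_leD (fc i Pi) IH.
by apply: straddle_le_ext IH => s; rewrite big_cons (negbTE Pi).
Qed.

Lemma is_derive_near f t d eps : is_derive t 1 f d -> 0 < eps ->
  exists2 e, 0 < e & forall s, `|s - t| < e ->
    `|f s - f t - d * (s - t)| <= eps * `|s - t|.
Proof.
move=> [fd fE] eps0; move: fd => /derivable_nbhsP.
rewrite fE => /eqaddoP/(_ _ eps0) => -[e /= e0 he].
exists e => // s st.
have := he (s - t).
rewrite /= sub0r normrN => /(_ st).
rewrite /shift /cst /= !fctE /GRing.scale /= mulr1 subrK opprD addrA.
by rewrite [d * _]mulrC.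
Qed.

Lemma is_derive_straddle f t d : is_derive t 1 f d -> straddle_le f t d.
Proof.
move=> fd eps eps0; have [e e0 he] := is_derive_near fd eps0.
exists e => // a b *.
have ha : `|a - t| < e by rewrite ltr_norml; apply/andP; split; lra.
have hb : `|b - t| < e by rewrite ltr_norml; apply/andP; split; lra.
have := he _ ha; have := he _ hb.
rewrite (ger0_norm (_ : 0 <= b - t)) 1?(ler0_norm (_ : a - t <= 0)); try lra.
by rewrite !ler_norml => /andP[_ ?] /andP[? _]; lra.
Qed.

(** Only the right endpoint needs a sign: once [f b >= 0], the increment of [|f|] is at most that of
    [f], whatever the sign of [f a]. *)
Lemma is_derive_straddle_norm_pos f t d : is_derive t 1 f d -> 0 < f t ->
  straddle_le (fun s => `|f s|) t d.
Proof.
move=> fd ft0 eps eps0; have [r r0 hr] := is_derive_near fd eps0.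
have K0 : 0 < `|d| + eps by rewrite addrC ltr_wpDr.
have [r' r'0 hr'] := is_derive_straddle fd eps0.
(* Within [f t / (|d| + eps)] of [t], the first-order expansion cannot bring [f b] below 0. *)
exists (Num.min r' (Num.min r (f t / (`|d| + eps)))).
  by rewrite !lt_min r0 r'0 divr_gt0.
move=> a b; rewrite ltrBlDr -ltrBlDl !lt_min -!ltrBlDl !lt_min.
move=> /and3P[? ? ?] ta tb /and3P[? ? btf].
have fb0 : 0 <= f b.
  have bt0 : 0 <= b - t by rewrite subr_ge0.
  have /hr : `|b - t| < r by rewrite ger0_norm.
  rewrite (ger0_norm bt0) ler_norml => /andP[+ _].
  move: btf; rewrite ltr_pdivlMr//.
  have : (b - t) * (- d) <= (b - t) * `|d| by rewrite ler_wpM2l// -normrN ler_norm.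
  lra.
rewrite (ger0_norm fb0); apply: (@le_trans _ _ (f b - f a)).
  by rewrite lerB// ler_norm.
by apply: hr' => //; lra.
Qed.

(** If [f t] is nonzero, [|f|] is locally [f] or [- f]. If [f t = 0], both hypotheses apply and give
    [|d| <= e]; then [|f b|] is bounded to first order and [- |f a| <= 0] is dropped. *)
Lemma is_derive_straddle_norm f t d e : is_derive t 1 f d ->
  (0 <= f t -> d <= e) -> (f t <= 0 -> - d <= e) ->
  straddle_le (fun s => `|f s|) t e.
Proof.
move=> fd pe ne; have [ft0|ft0|ft0] := ltgtP 0 (f t).
- by apply: straddle_le_weak (is_derive_straddle_norm_pos fd ft0); exact/pe/ltW.
- apply: (straddle_le_ext (f := fun s => `|(- f) s|)) => [s|]; first exact: normrN.
  apply: straddle_le_weak (is_derive_straddle_norm_pos (is_deriveN fd) _).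
    exact/ne/ltW.
  by rewrite oppr_gt0.
- have de : `|d| <= e by rewrite ler_norml lerNl pe ?ne ?ft0.
  move=> eps eps0; have [r r0 hr] := is_derive_near fd eps0.
  exists r => // a b *; have /hr : `|b - t| < r by rewrite ger0_norm; lra.
  rewrite -ft0 subr0 => fb.
  have : `|f b| <= (e + eps) * `|b - t|.
    rewrite -(subrK (d * (b - t)) (f b)) (le_trans (ler_normD _ _))//.
    by rewrite mulrDl addrC lerD// normrM ler_wpM2r.
  rewrite (@ger0_norm _ (b - t)) ?subr_ge0// => fb'.
  have : (e + eps) * (b - t) <= (e + eps) * (b - a).
    apply: ler_wpM2l; last lra.
    by have := normr_ge0 d; lra.
  by have := normr_ge0 (f a); lra.
Qed.

End Straddle.

(** * Absolute continuity and growth bounds from almost everywhere slopes *)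

Section AbsolutelyContinuous.
Context {R : realType}.
Implicit Types (f g : R -> R) (c d k T : R).

Lemma AC_dominated c d f g k :
  0 <= k -> (forall a b, `|f b - f a| <= k * `|g b - g a|) ->
  absolutely_continuous_on c d g -> absolutely_continuous_on c d f.
Proof.
move=> k0 fg ACg eps eps0.
have [|e e0 he] := ACg (eps / (k + 1)); first by rewrite divr_gt0//; lra.
exists e => // n a b ab tr /(he n a b ab tr); rewrite ltr_pdivlMr; last lra.
apply: le_lt_trans; apply: (@le_trans _ _ (\sum_(i < n) k * `|g (b i) - g (a i)|)).
  by apply: ler_sum.
rewrite -mulr_sumr mulrC ler_wpM2l ?lerDl//.
by apply: sumr_ge0.
Qed.

Lemma ACD c d f g : absolutely_continuous_on c d f -> absolutely_continuous_on c d g ->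
  absolutely_continuous_on c d (fun s => f s + g s).
Proof.
move=> ACf ACg eps eps0; have e20 : 0 < eps / 2 by lra.
have [e e0 he] := ACf _ e20; have [e' e'0 he'] := ACg _ e20.
exists (Num.min e e'); first by rewrite lt_min e0.
move=> n a b ab tr; rewrite lt_min => /andP[/(he n a b ab tr) h /(he' n a b ab tr) h'].
apply: (@le_lt_trans _ _ (\sum_(i < n) (`|f (b i) - f (a i)| + `|g (b i) - g (a i)|))).
  by apply: ler_sum => i _; rewrite opprD addrACA ler_normD.
by rewrite big_split/=; lra.
Qed.

Lemma AC_norm c d f : absolutely_continuous_on c d f ->
  absolutely_continuous_on c d (fun s => `|f s|).
Proof.
by apply: (@AC_dominated _ _ _ _ 1) => // a b; rewrite mul1r ler_dist_dist.
Qed.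

Lemma ACZ c d f k : absolutely_continuous_on c d f ->
  absolutely_continuous_on c d (fun s => k * f s).
Proof.
by apply: (@AC_dominated _ _ _ _ `|k|) => // a b; rewrite -mulrBr normrM.
Qed.

Lemma ACB c d f g : absolutely_continuous_on c d f -> absolutely_continuous_on c d g ->
  absolutely_continuous_on c d (fun s => f s - g s).
Proof.
move=> ACf ACg; apply: ACD => //.
by apply: (@AC_dominated _ _ _ g 1) => // a b; rewrite mul1r -opprD normrN.
Qed.

Lemma AC_sum (I : Type) (r : seq I) (P : pred I) (f : I -> R -> R) c d :
  (forall i, P i -> absolutely_continuous_on c d (f i)) ->
  absolutely_continuous_on c d (fun s => \sum_(i <- r | P i) f i s).
Proof.
move=> fc; elim: r => [|i r IH].
  move=> eps eps0; exists 1 => // n a b _ _ _.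
  by rewrite big1// => i _; rewrite !big_nil subrr normr0.
have [Pi|Pi] := boolP (P i).
  have -> : (fun s => \sum_(j <- i :: r | P j) f j s) =
            (fun s => f i s + \sum_(j <- r | P j) f j s).
    by apply/funext => s; rewrite big_cons Pi.
  exact: ACD (fc i Pi) IH.
have -> // : (fun s => \sum_(j <- i :: r | P j) f j s) =
            (fun s => \sum_(j <- r | P j) f j s).
by apply/funext => s; rewrite big_cons (negbTE Pi).
Qed.

(* The straddle bound handles the points outside a null set; the null set is
   covered by an open set [O] so small that absolute continuity bounds the
   variation of [f] on disjoint intervals inside [O]. *)
Lemma AC_straddle_le f c T : 0 <= c -> 0 <= T -> absolutely_continuous_on 0 T f ->
  {ae (@lebesgue_measure R), forall t, 0 < t <= T -> straddle_le f t c} ->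
  f T - f 0 <= c * T.
Proof.
move=> c0 T0 ACf [E [mE E0 sE]].
apply/ler_addgt0Pr => eps eps0.
have e2 : 0 < eps / 2 by lra.
(* This slope error costs at most [eps / 2] over [[0, T]]; the [+ 1] covers [T = 0]. *)
have e20 : 0 < eps / (2 * (T + 1)) by rewrite divr_gt0// mulr_gt0//; lra.
have [del del0 hdel] := ACf _ e2.
(* The point 0 joins the exceptional set because the slope bound is only known at positive times. *)
pose E' : set R := (E : set R) `|` [set 0].
have mE' : measurable E' by apply: measurableU => //; exact: measurable_set1.
have E'0 : lebesgue_measure E' = 0%E.
  apply/eqP; rewrite -measure_le0 (le_trans (measureU2 _ _ _))//=.
  by rewrite E0 lebesgue_measure_set1 adde0.
have [|O [oO E'O muO]] := lebesgue_regularity_outer mE' _ del0.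
  by rewrite [X in (X < _)%E](E'0 : _ = 0%E).
have mO : measurable O by exact: measurable_realfun.open_measurable.
have {}muO : (lebesgue_measure O < del%:E)%E.
  have mOE : measurable (O `\` E') by exact: measurableD.
  rewrite -(setDUK E'O); apply: le_lt_trans (measureU2 (@lebesgue_measure R) mE' mOE) _.
  by rewrite [X in (X + _)%E](E'0 : _ = 0%E) add0e.
(* The property given to [cousin]: [s] lists, from left to right, the exceptional pieces of
   [[a, b]]. The interval in the measure bound is half-open, so that adjacent intervals are disjoint
   and the measures add up. *)
pose P a b := exists s : seq (R * R), [/\
   all (fun p => (a <= p.1) && (p.1 <= p.2) && (p.2 <= b)) s,
   pairwise (fun p p' : R * R => p.2 <= p'.1) s,
   ((\sum_(p <- s) (p.2 - p.1))%:E <= lebesgue_measure (O `&` `[a, b[))%E &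
   f b - f a <= (c + eps / (2 * (T + 1))) * (b - a) + \sum_(p <- s) `|f p.2 - f p.1|].
have : P 0 T.
  apply: cousin => //.
  - move=> x y z x0 xy yz zT [s1 [in1 pw1 m1 v1]] [s2 [in2 pw2 m2 v2]].
    exists (s1 ++ s2); split.
    + rewrite all_cat; apply/andP; split.
        by apply: sub_all in1 => p /andP[/andP[-> ->] /le_trans]; exact.
      by apply: sub_all in2 => p /andP[/andP[/(le_trans xy) -> ->]].
    + rewrite pairwise_cat pw1 pw2 !andbT.
      apply/allrelP => p p' /(allP in1) /andP[_ py] /(allP in2) /andP[/andP[yp' _] _].
      exact: le_trans py yp'.
    + rewrite big_cat/= EFinD.
      rewrite (@itv_bndbnd_setU _ _ (BLeft x) (BLeft y) (BLeft z))//.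
      rewrite setIUr measureU; first exact: leeD.
      * by apply: measurableI.
      * by apply: measurableI.
      * by apply/seteqP; split => // w /= [[_]]; rewrite !in_itv/=; lra.
    + rewrite big_cat/=; lra.
  (* Near a point of [O] the whole interval is one exceptional piece; at any other point the slope
     bound suffices and the list is empty. *)
  - move=> t /andP[t0 tT]; have [tO|tO] := pselect (O t).
      have /nbhs_ballP[e /= e0 eO] := open_nbhs_nbhs (conj oO tO).
      exists e => // x y x0 yT tx xt ty yt; exists [:: (x, y)]; split => //=.
      * by rewrite !lexx (le_trans xt ty).
      * have -> : O `&` `[x, y[ = `[x, y[%classic.
          apply/setIidPr => w /=; rewrite in_itv/= => /andP[xw wy].
          by apply: eO; rewrite /ball/= ltr_distlC; apply/andP; split; lra.
        rewrite big_seq1 /= lebesgue_measure_itv/= lte_fin.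
        by case: ltP => //; rewrite lee_fin; lra.
      * rewrite big_seq1/= (le_trans (ler_norm _))// lerDr.
        by rewrite mulr_ge0 ?subr_ge0 ?(le_trans xt)// addr_ge0// ltW.
    have tgt0 : 0 < t <= T.
      rewrite lt_neqAle t0 tT !andbT eq_sym; apply/eqP => t00; apply: tO; apply: E'O.
      by right.
    have /(_ tgt0 _ e20)[e e0 he] : 0 < t <= T -> straddle_le f t c.
      by apply: contrapT => h; apply: tO; apply: E'O; left; exact: sE.
    exists e => // x y *; exists [::]; split => //=.
      by rewrite big_nil.
    by rewrite big_nil addr0; exact: he.
move=> [s [ins pws ms vs]].
pose p0 : R * R := (0, 0).
have sumE (F : R * R -> R) : \sum_(p <- s) F p = \sum_(k < size s) F (nth p0 s k).
  by rewrite (big_nth p0) big_mkord.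
have ink (k : 'I_(size s)) : nth p0 s k \in s by rewrite mem_nth.
pose av (k : 'I_(size s)) := (nth p0 s k).1.
pose bv (k : 'I_(size s)) := (nth p0 s k).2.
have := hdel (size s) av bv.
rewrite -(sumE (fun p => p.2 - p.1)) -(sumE (fun p => `|f p.2 - f p.1|)) => hs.
have {}hs : \sum_(p <- s) `|f p.2 - f p.1| < eps / 2.
  apply: hs.
  - by move=> k; have /allP/(_ _ (ink k))/andP[/andP[]] := ins.
  - move=> k l _ _ [w]; rewrite /setI/= !in_itv/= => -[/andP[kw wk] /andP[lw wl]].
    have pw (k' l' : 'I_(size s)) : (k' < l')%N -> bv k' <= av l'.
      by move=> kl; have /(pairwiseP p0) := pws; apply; rewrite ?inE.
    apply: val_inj; case: (ltngtP k l) => [kl|lk|//].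
      by have := lt_le_trans (lt_trans lw wk) (pw _ _ kl); rewrite ltxx.
    by have := lt_le_trans (lt_trans kw wl) (pw _ _ lk); rewrite ltxx.
  - rewrite -lte_fin; apply: le_lt_trans ms _; apply: le_lt_trans muO.
    by apply: le_measure; rewrite ?inE//; exact: measurableI.
rewrite subr0 in vs; apply: (le_trans vs).
have : eps / (2 * (T + 1)) * T <= eps / 2.
  rewrite invfM mulrA -mulrA ler_piMr//; first lra.
  by rewrite mulrC ler_pdivrMr; lra.
lra.
Qed.
End AbsolutelyContinuous.

(** Otherwise the partial sums of the harmonic series would be nondecreasing and bounded, hence
    convergent. *)
Lemma harmonic_tail_unbounded (R : realType) (K : nat) (C : R) :
  exists2 N, (K <= N)%N & C < \sum_(K <= n < N) n.+1%:R^-1.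
Proof.
apply: contrapT => h; apply: (@dvg_harmonic R).
apply: nondecreasing_is_cvgn.
  by apply: nondecreasing_series => n _ _; exact: harmonic_ge0.
exists (\sum_(0 <= n < K) n.+1%:R^-1 + C) => _ [N _ <-].
rewrite /series/=.
have NK : (N <= maxn K N)%N by rewrite leq_maxr.
apply: (@le_trans _ _ (\sum_(0 <= n < maxn K N) n.+1%:R^-1)).
  by rewrite (@big_cat_nat _ _ _ N 0 (maxn K N))//= lerDl sumr_ge0.
rewrite (@big_cat_nat _ _ _ K 0 (maxn K N)) ?leq_maxl//= lerD2l leNgt.
by apply/negP => lt; apply: h; exists (maxn K N); rewrite ?leq_maxl.
Qed.

(** * The order on indices and the existence of maxima *)

Section Order.
Context {R : realType} {m : nat} (u : 'I_m.+1 -> R -> R).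
Implicit Types x y z : state_index m.

Lemma prec_irr x : ~~ (prec u x x).
Proof. by rewrite /prec !ltxx andbF. Qed.

Lemma prec_trans y x z : prec u x y -> prec u y z -> prec u x z.
Proof.
move=> /orP[xy|/andP[/eqP xy lxy]] /orP[yz|/andP[/eqP yz lyz]]; apply/orP.
- by left; exact: lt_trans xy yz.
- by left; rewrite -yz.
- by left; rewrite xy.
- by right; rewrite xy yz eqxx /=; exact: lt_trans lyz lxy.
Qed.

Lemma prec_total x y : x != y -> prec u x y || prec u y x.
Proof.
move=> xy; have : (x : 'I_m.+1 *l nat) != y by [].
by rewrite neq_lt /prec orbC; case: (ltgtP (Delta u x.1 _)).
Qed.

Context (u_concave : forall i, concave_on `[0, +oo[ (u i)).

(** Concavity at [j + 1], the midpoint of [j] and [j + 2]. *)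
Lemma Delta_nonincreasing i j : Delta u i j.+1 <= Delta u i j.
Proof.
have h2 : 0 <= 2^-1 :> R by rewrite invr_ge0.
have h21 : 2^-1 <= 1 :> R by rewrite invf_le1// ler1n.
have /(_ j%:R j.+2%:R) h := @u_concave i (Itv01 h2 h21).
rewrite /Delta; move: h; rewrite !inE /= !in_itv /= !andbT !ler0n => /(_ isT isT).
set c := (X in - u i X <= _); have -> : c = j.+1%:R.
  by rewrite /c [LHS](@convRE R)/= /unstable.onem -[j.+2]addn2 -[j.+1]addn1 !natrD; lra.
rewrite convRE/= /unstable.onem; lra.
Qed.

(** When concavity gives only equal increments, the reversed lexicographic tie-break decides. *)
Lemma prec_lt i j k : (1 <= j < k)%N -> prec u (i, k) (i, j).
Proof.
move=> /andP[j1 jk].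
have : (Delta u i k.-1 <= Delta u i j.-1).
  have /nonincreasing_seqP : forall n, Delta u i n.+1 <= Delta u i n.
    exact: Delta_nonincreasing.
  by apply; rewrite -!subn1 leq_sub2r// ltnW.
rewrite /prec /= le_eqVlt => /orP[->|->//]; rewrite andTb; apply/orP; right.
by rewrite ltxi_pair lexx.
Qed.

(** By [prec_lt], the lowest level of [A] within a class is the maximum of that class. There are
    finitely many classes, and an induction on a list of them compares these maxima. *)
Lemma maximum_exists (A : set (state_index m)) :
  A `<=` index_pos (m := m) -> A !=set0 -> exists x, is_maximum u A x.
Proof.
move=> Apos [a Aa].
suff H (s : seq 'I_m.+1) : (exists2 x, A x & x.1 \in s) ->
    exists x, is_maximum u [set y | A y /\ y.1 \in s] x.
  have [|x [[Ax _] xmax]] := H (enum 'I_m.+1).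
    by exists a; rewrite // mem_enum.
  exists x; split=> // y Ay; apply: xmax; split => //.
  by rewrite mem_enum.
elim: s => [[x]|i s IH]; first by rewrite in_nil.
have [Ai|Ai] := pselect (exists j, A (i, j)); last first.
  move=> [x Ax]; rewrite in_cons => /predU1P[xi|xs].
    by case: Ai; exists x.2; rewrite -xi -surjective_pairing.
  have [|y [[Ay ys] ymax]] := IH; first by exists x.
  exists y; split; first by rewrite /= in_cons ys orbT.
  move=> z /= [Az]; rewrite in_cons => /predU1P[zi|zs]; last exact: ymax.
  by case: Ai; exists z.2; rewrite -zi -surjective_pairing.
move=> _; have {Ai}[j Aj jmin] : exists2 j, A (i, j) & forall k, A (i, k) -> (j <= k)%N.
  have exj : exists j, `[< A (i, j) >] by case: Ai => j ?; exists j; exact/asboolP.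
  exists (ex_minn exj); first by case: ex_minnP => j /asboolP.
  by case: ex_minnP => j _ jmin k Ak; apply: jmin; exact/asboolP.
have {}jmin k : A (i, k) -> (i, k) <> (i, j) -> prec u (i, k) (i, j).
  move=> Ak kj; apply: prec_lt; rewrite (Apos _ Aj) /= ltn_neqAle jmin// andbT.
  by apply/eqP => jk; apply: kj; rewrite jk.
have [As|As] := pselect (exists2 x, A x & x.1 \in s); last first.
  exists (i, j); split; first by rewrite /= mem_head.
  move=> [k l] /= [Akl]; rewrite in_cons => /predU1P[ki|ks].
    by rewrite ki in Akl *; exact: jmin.
  by case: As; exists (k, l).
have [y [[Ay ys] ymax]] := IH As.
have [yij|yij] := eqVneq y (i, j).
  exists y; split; first by rewrite /= in_cons ys orbT.
  move=> [k l] /= [Akl]; rewrite in_cons => /predU1P[ki|ks]; last by apply: ymax.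
  by rewrite yij ki in Akl *; exact: jmin.
have /orP[yp|py] := prec_total yij.
  exists (i, j); split; first by rewrite /= mem_head.
  move=> [k l] /= [Akl]; rewrite in_cons => /predU1P[ki|ks].
    by rewrite ki in Akl *; exact: jmin.
  move=> _; have [<-//|kly] := eqVneq y (k, l).
  by apply: prec_trans yp; apply: ymax => //; apply/eqP; rewrite eq_sym.
exists y; split; first by rewrite /= in_cons ys orbT.
move=> [k l] /= [Akl]; rewrite in_cons => /predU1P[ki|ks]; last by apply: ymax.
rewrite ki in Akl * => _; have [->//|lj] := eqVneq (i, l) (i, j).
by apply: prec_trans py; apply: jmin => //; exact/eqP.
Qed.

End Order.

(** * Sums over finitely many levels *)

(** Levels start at 1: level 0 lies outside [index_pos] and is fixed to [alpha] in every state. *)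
Definition box m n : seq (state_index m) :=
  [seq (i, j) | i <- enum 'I_m.+1, j <- iota 1 n].

Lemma mem_box m n (x : state_index m) : (x \in box m n) = (1 <= x.2 <= n)%N.
Proof.
case: x => i j; apply/allpairsP/idP => /= [[[k l] /= [_ + [_ ->]]]|jn].
  by rewrite mem_iota add1n ltnS.
by exists (i, j); rewrite mem_enum mem_iota add1n ltnS.
Qed.

Lemma box_uniq m n : uniq (box m n).
Proof. by rewrite allpairs_uniq ?enum_uniq ?iota_uniq// => -[? ?] [? ?] _ _ [-> ->]. Qed.

Lemma sum_box (R : realType) m n (F : state_index m -> R) :
  \sum_(x <- box m n) F x = \sum_(i < m.+1) \sum_(1 <= j < n.+1) F (i, j).
Proof. by rewrite big_allpairs big_enum; apply: eq_bigr => i _; rewrite /index_iota subSS subn0. Qed.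

Lemma sum_box_le (R : realType) m n n' (F : state_index m -> R) :
  (n <= n')%N -> (forall x, index_pos x -> 0 <= F x) ->
  \sum_(x <- box m n) F x <= \sum_(x <- box m n') F x.
Proof.
move=> nn' F0; rewrite !sum_box; apply: ler_sum => i _.
rewrite (@big_cat_nat _ _ _ n.+1 1 n'.+1)//= lerDl big_nat_cond sumr_ge0// => j.
by rewrite andbT => /andP[nj _]; apply: F0 => /=; exact: leq_trans nj.
Qed.

(** Summation by parts: within a class the sum equals [n F(n+1) - (F(1) + ... + F(n))], and the
    subtracted terms are nonnegative. *)
Lemma sum_box_telescope (R : realType) m n (F : state_index m -> R) :
  (forall x, 0 <= F x) ->
  \sum_(x <- box m n) x.2%:R * (F (x.1, x.2.+1) - F x) <=
  n%:R * \sum_(i < m.+1) F (i, n.+1).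
Proof.
move=> F0; rewrite sum_box mulr_sumr; apply: ler_sum => i _ /=.
elim: n => [|n IH]; first by rewrite big_geq// mul0r.
rewrite big_nat_recr//=; apply: (le_trans (lerD IH (lexx _))).
have := F0 (i, n.+1); rewrite -[n.+1]addn1 natrD; lra.
Qed.

(** * States, full levels and arrival rates *)

Section FluidModelTheory.
Context {R : realType} {m : nat} {u : 'I_m.+1 -> R -> R}.
Context {lambda mu : R} {alpha : 'I_m.+1 -> R}.
Context (u_concave : forall i, concave_on `[0, +oo[ (u i)).
Context (mu_gt0 : 0 < mu) (alpha_gt0 : forall i, 0 < alpha i).
Implicit Types (p q : state_index m -> R) (x y : state_index m).
Local Notation sigma := (sigma u).
Local Notation prec := (prec u).
Local Notation Lambda := (Lambda u lambda mu alpha).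
Local Notation next x := (x.1, x.2.+1).

Lemma Qset_ge0 q x : Qset alpha q -> 0 <= q x.
Proof. by move=> [/(_ x)/andP[]]. Qed.

Lemma Qset_le_alpha q x : Qset alpha q -> q x <= alpha x.1.
Proof. by case: x => i j [_ _ /(_ i j)[_ + <-]]. Qed.

Lemma Qset_nonincreasing q i j k : Qset alpha q -> (j <= k)%N -> q (i, k) <= q (i, j).
Proof.
move=> [_ _ Qq]; have /nonincreasing_seqP h : forall n, q (i, n.+1) <= q (i, n).
  by move=> n; case: (Qq i n).
exact: h.
Qed.

Lemma Qset_sum_bounded q : Qset alpha q ->
  exists M, forall n, \sum_(x <- box m n) q x <= M.
Proof.
move=> Qq; have [_ sq _] := Qq.
have q0 x : 0 <= q x by exact: Qset_ge0.
exists (fine (\esum_(x in setT) `|(q x)%:E|)%E) => n.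
rewrite -lee_fin fineK; last first.
  by rewrite ge0_fin_numE//; apply: esum_ge0 => x _.
apply: ereal_sup_ubound; exists [set` box m n].
  by split=> //; exact: finite_seq.
rewrite -fsbig_seq ?box_uniq//= -sumEFin.
by apply: eq_bigr => x _; rewrite ger0_norm.
Qed.

Definition full_bound (M : R) : nat := \max_i (Num.truncn (M / alpha i)).+1.

(** If level [j] of class [i] is full, monotonicity puts mass at least [j * alpha i] on levels 1 to
    [j], so [j <= M / alpha i]. *)
Lemma full_lt_bound q M : Qset alpha q ->
  (forall n, \sum_(x <- box m n) q x <= M) ->
  forall x, q x = alpha x.1 -> (x.2 < full_bound M)%N.
Proof.
move=> Qq qM [i j] /= qx; apply: leq_trans (leq_bigmax i).
rewrite -(ltr_nat R); apply: le_lt_trans (truncnS_gt _).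
rewrite ler_pdivlMr//; apply: le_trans (qM j).
rewrite sum_box (bigD1 i)//=.
apply: (@le_trans _ _ (\sum_(1 <= k < j.+1) q (i, k))).
  have -> : j%:R * alpha i = \sum_(1 <= k < j.+1) q (i, j).
    by rewrite -qx sumr_const_nat subn1 mulr_natl.
  apply: ler_sum_nat => k /andP[_ kj]; exact: Qset_nonincreasing.
rewrite lerDl sumr_ge0// => k _; apply: sumr_ge0 => l _; exact: Qset_ge0.
Qed.

(** The default value of [sigma] is never taken: without any strict descent, class [ord0] would be
    full at all levels, against the finite mass. *)
Lemma sigma_maximum q : Qset alpha q ->
  is_maximum u [set x | index_pos x /\ q (x.1, x.2.-1) > q x] (sigma q).
Proof.
move=> Qq; apply: xgetPex; apply: maximum_exists => //; first by move=> x [].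
have [M qM] := Qset_sum_bounded Qq.
apply: contrapT => h.
have full j : q (ord0, j) = alpha ord0.
  elim: j => [|j <-]; first by have [_ _ /(_ ord0 0%N)[]] := Qq.
  apply/eqP; rewrite eq_le Qset_nonincreasing//= leNgt; apply/negP => qj.
  by apply: h; exists (ord0, j.+1).
by have := full_lt_bound Qq qM (full (full_bound M)); rewrite ltnn.
Qed.

Lemma sigma_pos q : Qset alpha q -> index_pos (sigma q).
Proof. by move=> /sigma_maximum[[]]. Qed.

Lemma sigma_lt_alpha q : Qset alpha q -> q (sigma q) < alpha (sigma q).1.
Proof.
move=> Qq; have [[_ /lt_le_trans h] _] := sigma_maximum Qq.
by apply: h; exact: Qset_le_alpha Qq.
Qed.

(** Lower levels of the same class are still larger for the order, so by maximality there is no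
    descent between level 0, which is full, and [x]. *)
Lemma full_above_sigma q x : Qset alpha q -> index_pos x -> prec (sigma q) x ->
  q x = alpha x.1.
Proof.
case: x => i j Qq + sx /=.
have h k : (k <= j)%N -> q (i, k) = alpha i; last by move=> _; exact: h.
elim: k => [|k IH] kj; first by have [_ _ /(_ i 0%N)[]] := Qq.
rewrite -IH ?(ltnW kj)//.
apply/eqP; rewrite eq_le Qset_nonincreasing//= leNgt; apply/negP => qk.
have sk : prec (sigma q) (i, k.+1).
  move: kj; rewrite leq_eqVlt => /orP[/eqP->//|kj].
  by apply: prec_trans sx _; exact: prec_lt.
have [_ /(_ (i, k.+1))] := sigma_maximum Qq.
have [eks|neks] := eqVneq (i, k.+1) (sigma q).
  by move: sk; rewrite -eks (negbTE (prec_irr _ _)).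
move=> /(_ (conj isT qk))/(_ (elimN eqP neks)) ks.
by have := prec_trans sk ks; rewrite (negbTE (prec_irr _ _)).
Qed.

Lemma Lambda_below q x : prec x (sigma q) -> Lambda q x = 0.
Proof.
move=> xs; rewrite /Lambda xs; case: eqP => // xE.
by move: xs; rewrite {1}xE (negbTE (prec_irr _ _)).
Qed.

Lemma Lambda_above q x : prec (sigma q) x ->
  Lambda q x = mu * x.2%:R * (alpha x.1 - q (next x)).
Proof.
move=> xs; rewrite /Lambda; case: eqP => [xE|_].
  by move: xs; rewrite {1}xE (negbTE (prec_irr _ _)).
case: ifP => // sx.
by have := prec_trans sx xs; rewrite (negbTE (prec_irr _ _)).
Qed.

(** The rate at [sigma q] is [lambda] minus all rates above it, and rates below vanish. It remains
    to see that the box contains [sigma q] and everything above. *)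
Lemma Lambda_sum q n : Qset alpha q ->
  (forall x, q x = alpha x.1 -> (x.2 < n)%N) ->
  \sum_(x <- box m n) Lambda q x = lambda.
Proof.
move=> Qq full_lt.
(* The level just before [sigma q] is full, hence strictly less than [n], so the level of [sigma q]
   is at most [n]. *)
have sbox : sigma q \in box m n.
  rewrite mem_box (sigma_pos Qq)/=.
  case E : (sigma q) (sigma_pos Qq) => [i [|[|j]]] //= _.
    apply: leq_ltn_trans (full_lt (i, 0%N) _) => //.
    by have [_ _ /(_ i 0%N)[]] := Qq.
  apply: (full_lt (i, j.+1)); apply: full_above_sigma => //.
  by rewrite E; apply: prec_lt => //=; exact: ltnSn.
rewrite (bigD1_seq _ sbox) ?box_uniq//= {1}/Lambda eqxx.
have -> : [set y | index_pos y /\ prec (sigma q) y] =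
          [set` [seq y <- box m n | prec (sigma q) y]].
  apply/seteqP; split => y /=; rewrite mem_filter mem_box.
    move=> [y0 sy]; rewrite sy y0 /=; apply/ltnW/full_lt.
    exact: full_above_sigma.
  by move=> /and3P[sy y0 _].
rewrite -fsbig_seq ?filter_uniq ?box_uniq// big_filter.
rewrite [X in _ - X](_ : _ = \sum_(x <- box m n | x != sigma q) Lambda q x) ?subrK//.
rewrite big_mkcond [RHS]big_mkcond/=; apply: eq_bigr => x _.
have [->|xs] := eqVneq x (sigma q); first by rewrite (negbTE (prec_irr _ _)).
have /orP[xp|px] := prec_total u xs.
  rewrite Lambda_below//; case: ifP => // px.
  by have := prec_trans px xp; rewrite (negbTE (prec_irr _ _)).
by rewrite px Lambda_above.
Qed.

(** The rates are nonnegative, so the box can be enlarged until [Lambda_sum] applies. *)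
Lemma Lambda_sum_le q n : Qset alpha q ->
  (forall x, index_pos x -> 0 <= Lambda q x) ->
  \sum_(x <- box m n) Lambda q x <= lambda.
Proof.
move=> Qq L0; have [M qM] := Qset_sum_bounded Qq.
rewrite -[leRHS](Lambda_sum (q := q) (n := maxn n (full_bound M)))//.
  by apply: sum_box_le => //; exact: leq_maxl.
by move=> x qx; apply: leq_trans (leq_maxr _ _); exact: full_lt_bound qM _ qx.
Qed.

(* [d] is the time derivative of [q x - p x], so this says that [|q x - p x|]
   grows at rate at most [e]. Above [sigma q] both are full and [d = 0]; at
   [sigma q], [p] is full and [q] is not, unless the maxima coincide; below,
   [q] receives no arrivals. *)
Lemma drift_dist q p x :
  Qset alpha q -> Qset alpha p -> (forall y, index_pos y -> 0 <= Lambda p y) ->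
  prec (sigma p) (sigma q) \/
    sigma p = sigma q /\ Lambda q (sigma q) <= Lambda p (sigma q) ->
  index_pos x ->
  let d := (Lambda q x - mu * x.2%:R * (q x - q (next x))) -
           (Lambda p x - mu * x.2%:R * (p x - p (next x))) in
  let e := Lambda p x - Lambda q x +
           mu * (x.2%:R * (`|q (next x) - p (next x)| - `|q x - p x|)) in
  (0 <= q x - p x -> d <= e) /\ (q x - p x <= 0 -> - d <= e).
Proof.
move=> Qq Qp Lp0 spq x0 /=.
set D := q x - p x; set D' := q (next x) - p (next x).
have muj : 0 <= mu * x.2%:R by rewrite mulr_ge0// ltW.
have le1 : mu * x.2%:R * D' <= mu * x.2%:R * `|D'| by rewrite ler_wpM2l// ler_norm.
have le2 : mu * x.2%:R * - D' <= mu * x.2%:R * `|D'|.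
  by rewrite ler_wpM2l// -normrN ler_norm.
have -> : mu * x.2%:R * (q x - q (next x)) =
          mu * x.2%:R * (p x - p (next x)) + mu * x.2%:R * D - mu * x.2%:R * D'.
  by rewrite /D /D'; ring.
rewrite mulrA mulrBr.
have pfull y : index_pos y -> prec (sigma q) y -> p y = alpha y.1.
  move=> y0 sy; apply: full_above_sigma => //.
  by case: spq => [h|[->//]]; exact: prec_trans h sy.
have [sx|sx] := boolP (prec (sigma q) x).
  have D0 : D = 0 by rewrite /D pfull// full_above_sigma// subrr.
  have px : prec (sigma p) x.
    by case: spq => [h|[->//]]; exact: prec_trans h sx.
  rewrite !Lambda_above// D0 normr0.
  have -> : mu * x.2%:R * (alpha x.1 - q (next x)) =
            mu * x.2%:R * (alpha x.1 - p (next x)) - mu * x.2%:R * D'.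
    by rewrite /D'; ring.
  by split=> _; lra.
have [xs|xs] := eqVneq x (sigma q).
  case: spq => [h|[_ h]]; last first.
    rewrite -xs in h.
    by split=> [/ger0_norm->|/ler0_norm->]; lra.
  have Dlt0 : D < 0.
    have px : p x = alpha x.1 by apply: full_above_sigma => //; rewrite xs.
    by rewrite /D subr_lt0 px xs; exact: sigma_lt_alpha.
  by split=> [|/ler0_norm->]; lra.
have {}sx : prec x (sigma q) by move: (prec_total u xs); rewrite (negbTE sx) orbF.
rewrite (Lambda_below sx); have := Lp0 _ x0.
by split=> [/ger0_norm->|/ler0_norm->]; lra.
Qed.

End FluidModelTheory.

(** * Growth of the distance between trajectories, and uniqueness *)

Section FluidTrajectories.
Context {R : realType} {m : nat} {u : 'I_m.+1 -> R -> R}.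
Context {lambda mu : R} {alpha : 'I_m.+1 -> R}.
Context (u_concave : forall i, concave_on `[0, +oo[ (u i)).
Context (lambda_gt0 : 0 < lambda) (mu_gt0 : 0 < mu) (alpha_gt0 : forall i, 0 < alpha i).
Implicit Types (p q : R -> state_index m -> R) (x y : state_index m).
Local Notation Lambda := (Lambda u lambda mu alpha).
Local Notation next x := (x.1, x.2.+1).
Local Notation fluid_trajectory := (fluid_trajectory u lambda mu alpha).

Definition solves_at q (t : R) := forall x, index_pos x ->
  is_derive t 1 (q ^~ x) (Lambda (q t) x - mu * x.2%:R * (q t x - q t (next x))) /\
  0 <= Lambda (q t) x.

(** Summing [drift_dist] over the box, the arrival terms cancel since both total [lambda], and
    [sum_box_telescope] leaves only the flux into level [n]. *)
Lemma dist_straddle p q t n :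
  Qset alpha (q t) -> Qset alpha (p t) -> solves_at q t -> solves_at p t ->
  (forall x, q t x = alpha x.1 -> (x.2 < n)%N) ->
  (forall x, p t x = alpha x.1 -> (x.2 < n)%N) ->
  straddle_le (fun s => \sum_(x <- box m n) `|q s x - p s x|) t
    (mu * (n%:R * \sum_(i < m.+1) `|q t (i, n.+1) - p t (i, n.+1)|)).
Proof.
move=> Qq Qp odeq odep fullq fullp.
(* The bound is symmetric in [p] and [q], so the one with the larger maximum may be called [q];
   equal maxima are separated by the rates there. *)
wlog spq : p q Qq Qp odeq odep fullq fullp /
    prec u (sigma u (p t)) (sigma u (q t)) \/
    sigma u (p t) = sigma u (q t) /\
      Lambda (q t) (sigma u (q t)) <= Lambda (p t) (sigma u (q t)).
  move=> H.
  have sym : straddle_le (fun s => \sum_(x <- box m n) `|p s x - q s x|) t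
      (mu * (n%:R * \sum_(i < m.+1) `|p t (i, n.+1) - q t (i, n.+1)|)) ->
    straddle_le (fun s => \sum_(x <- box m n) `|q s x - p s x|) t
      (mu * (n%:R * \sum_(i < m.+1) `|q t (i, n.+1) - p t (i, n.+1)|)).
    under [in X in _ -> X]eq_bigr do rewrite distrC.
    by apply: straddle_le_ext => s; apply: eq_bigr => x _; rewrite distrC.
  have [spq|spq] := eqVneq (sigma u (p t)) (sigma u (q t)).
    have [L|L] := leP (Lambda (q t) (sigma u (q t))) (Lambda (p t) (sigma u (q t))).
      by apply: H => //; right.
    by apply/sym/H => //; right; rewrite spq; split => //; exact: ltW.
  have /orP[ps|qs] := prec_total u spq; first by apply: H => //; left.
  by apply/sym/H => //; left.
pose e x := Lambda (p t) x - Lambda (q t) x +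
  mu * (x.2%:R * (`|q t (next x) - p t (next x)| - `|q t x - p t x|)).
apply: (@straddle_le_weak _ _ _ (\sum_(x <- box m n) e x)).
  rewrite big_split/= sumrB !Lambda_sum// subrr add0r -mulr_sumr ler_wpM2l ?(ltW mu_gt0)//.
  exact: (sum_box_telescope n (F := fun x => `|q t x - p t x|)).
(* The redundant condition on levels supplies [index_pos] to the termwise argument. *)
apply: (straddle_le_ext (f := fun s => \sum_(x <- box m n | (1 <= x.2)%N) `|q s x - p s x|)).
  move=> s; rewrite big_mkcond/=; apply: eq_big_seq => x.
  by rewrite mem_box => /andP[->].
rewrite [X in straddle_le _ _ X](_ : _ = \sum_(x <- box m n | (1 <= x.2)%N) e x); last first.
  rewrite [RHS]big_mkcond/=; apply: eq_big_seq => x.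
  by rewrite mem_box => /andP[->].
apply: straddle_le_sum => x x0.
have [dq _] := odeq x x0; have [dp _] := odep x x0.
have Lp0 y : index_pos y -> 0 <= Lambda (p t) y by move=> /odep[].
have [pe ne] := drift_dist u_concave mu_gt0 alpha_gt0 Qq Qp Lp0 spq x0.
exact: is_derive_straddle_norm (is_deriveB dq dp) pe ne.
Qed.

(** Arrivals add mass at total rate at most [lambda] and departures only remove it, so the initial
    mass plus [lambda * T] is a bound, uniformly in [n]. *)
Lemma fluid_mass_bounded q T : 0 < T -> fluid_trajectory q ->
  exists2 M, 0 <= M & forall t n, 0 <= t <= T -> \sum_(x <- box m n) q t x <= M.
Proof.
move=> T0 [Qq ACq odeq].
have [M qM] := Qset_sum_bounded (Qq 0 (lexx _)).
have M0 : 0 <= M by have := qM 0%N; rewrite sum_box big1// => i _; rewrite big_geq.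
exists (M + lambda * T); first by rewrite addr_ge0// mulr_ge0// ltW.
move=> t n /andP[]; rewrite le_eqVlt => /predU1P[<- _|t0 tT].
  by rewrite (le_trans (qM n))// lerDl mulr_ge0// ltW.
have : \sum_(x <- box m n) q t x - \sum_(x <- box m n) q 0 x <= lambda * t.
  apply: (AC_straddle_le (f := fun t => \sum_(x <- box m n) q t x)); [exact: ltW|exact: ltW| |].
    by apply: AC_sum => x _; exact: ACq.
  have aeF := ae_filter_ringOfSetsType (@lebesgue_measure R).
  apply: filterS odeq => s odes /andP[s0 _].
  have {}odes : solves_at q s by exact: odes s0.
  have Qs := Qq s (ltW s0).
  pose d x := Lambda (q s) x - mu * x.2%:R * (q s x - q s (next x)).
  apply: (@straddle_le_weak _ _ _ (\sum_(x <- box m n | (1 <= x.2)%N) d x)); last first.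
    apply: (straddle_le_ext (f := fun s => \sum_(x <- box m n | (1 <= x.2)%N) q s x)).
      move=> r; rewrite big_mkcond/=; apply: eq_big_seq => x.
      by rewrite mem_box => /andP[->].
    by apply: straddle_le_sum => x x0; apply: is_derive_straddle; have [] := odes x x0.
  apply: (@le_trans _ _ (\sum_(x <- box m n) Lambda (q s) x)); last first.
    by apply: Lambda_sum_le => // x /odes[].
  rewrite big_mkcond/= big_seq [leRHS]big_seq; apply: ler_sum => -[i j].
  rewrite mem_box => /andP[-> _]; rewrite gerBl !mulr_ge0// ?(ltW mu_gt0)//.
  by rewrite subr_ge0; exact: (Qset_nonincreasing _ Qs (leqnSn j)).
move=> h; have : lambda * t <= lambda * T by rewrite ler_pM2l.
by have := qM n; lra.
Qed.

(** Uniformity in time lets one starting level for the weighted sum serve the whole of [[0, T]]. *)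
Lemma fluid_full_bounded q T : 0 < T -> fluid_trajectory q ->
  exists K, forall t x, 0 <= t <= T -> q t x = alpha x.1 -> (x.2 < K)%N.
Proof.
move=> T0 fq; have [M M0 qM] := fluid_mass_bounded T0 fq.
have [Qq _ _] := fq.
exists (@full_bound R m alpha M) => t x tT; apply: full_lt_bound => //.
  by apply: Qq; case/andP: tT.
by move=> n; exact: qM.
Qed.

Lemma fluid_trajectory_unique p q : fluid_trajectory p -> fluid_trajectory q ->
  p 0 = q 0 -> forall t, 0 <= t -> p t = q t.
Proof.
move=> fp fq pq0 T; rewrite le_eqVlt => /predU1P[<-//|T0].
have [Qp ACp odep] := fp; have [Qq ACq odeq] := fq.
have [M M0 pM] := fluid_mass_bounded T0 fp.
have [M' M'0 qM'] := fluid_mass_bounded T0 fq.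
have [K pK] := fluid_full_bounded T0 fp.
have [K' qK'] := fluid_full_bounded T0 fq.
pose D t x := `|p t x - q t x|.
have DM t n : 0 <= t <= T -> \sum_(x <- box m n) D t x <= M + M'.
  move=> tT; apply: le_trans (lerD (pM t n tT) (qM' t n tT)); rewrite -big_split/=.
  have t0 : 0 <= t by case/andP: tT.
  apply: ler_sum => x _; rewrite (le_trans (ler_normB _ _))//.
  by rewrite !ger0_norm// (Qset_ge0 _ (Qp t t0), Qset_ge0 _ (Qq t t0)).
apply/funext => -[i j].
case: j => [|j].
  have [_ _ /(_ i 0%N)[_ _ ->]] := Qp T (ltW T0).
  by have [_ _ /(_ i 0%N)[_ _ ->]] := Qq T (ltW T0).
apply/eqP; rewrite -subr_eq0 -normr_eq0 eq_le normr_ge0 andbT leNgt; apply/negP => D0.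
(* From [k] on, every box [n.+1] contains [(i, j.+1)] and exceeds the levels that either trajectory
   can fill up to time [T]. *)
pose k := maxn j (maxn K K').
(* Since [D T (i, j.+1)] occurs in each box sum, [F T] would exceed [mu * (M + M') * T], against the
   growth bound proved below. *)
have [N kN] := harmonic_tail_unbounded k (mu * (M + M') * T / D T (i, j.+1)).
rewrite ltr_pdivrMr// mulr_suml; apply/negP; rewrite -leNgt.
pose F t := \sum_(k <= n < N) n.+1%:R^-1 * \sum_(x <- box m n.+1) D t x.
apply: (@le_trans _ _ (F T)).
  apply: ler_sum_nat => n /andP[kn _].
  rewrite ler_wpM2l// (bigD1_seq (i, j.+1)) ?box_uniq//=; last first.
    by rewrite mem_box/= ltnS (leq_trans _ kn)// leq_maxl.
  by rewrite lerDl sumr_ge0// => x _; exact: normr_ge0.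
have F0 : F 0 = 0.
  rewrite /F big1// => n _; rewrite [X in _ * X]big1 ?mulr0// => x _.
  by rewrite /D pq0 subrr normr0.
rewrite -[F T]subr0 -F0; apply: (AC_straddle_le (f := F)).
- by rewrite mulr_ge0 ?addr_ge0// ltW.
- exact: ltW.
- apply: AC_sum => n _; apply: ACZ; apply: AC_sum => x _; apply: AC_norm.
  by apply: ACB; [exact: ACp|exact: ACq].
have aeF := ae_filter_ringOfSetsType (@lebesgue_measure R).
apply: filterS2 odep odeq => t odep odeq tT.
have [t0 _] := andP tT.
have {}tT : 0 <= t <= T by rewrite (ltW t0); case/andP: tT.
have {}odep : solves_at p t by exact: odep t0.
have {}odeq : solves_at q t by exact: odeq t0.
(* Weight times flux bound for box [n.+1]; the factors [n.+1] cancel. *)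
pose c n := n.+1%:R^-1 * (mu * (n.+1%:R * \sum_(i < m.+1) D t (i, n.+2))).
apply: (@straddle_le_weak _ _ _ (\sum_(k <= n < N | (k <= n)%N) c n)); last first.
  apply: (straddle_le_ext (f := fun t =>
    \sum_(k <= n < N | (k <= n)%N) n.+1%:R^-1 * \sum_(x <- box m n.+1) D t x)).
    move=> s; rewrite big_mkcond/= /F; apply: eq_big_seq => n.
    by rewrite mem_index_iota => /andP[->].
  apply: straddle_le_sum => n kn; apply: straddle_leZ => //.
  have Kn : (K <= n.+1)%N by rewrite (leq_trans _ (leqW kn))// /k !leq_max leqnn orbT.
  have K'n : (K' <= n.+1)%N by rewrite (leq_trans _ (leqW kn))// /k !leq_max leqnn !orbT.
  apply: dist_straddle => //; [exact/Qp/ltW|exact/Qq/ltW| |].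
    by move=> x /(pK _ _ tT) /leq_trans; exact.
  by move=> x /(qK' _ _ tT) /leq_trans; exact.
rewrite big_mkcond/=.
(* The terms left involve the distinct levels [k.+2] to [N.+1], so together they are at most [mu]
   times the sum over box [N.+1]. *)
apply: (@le_trans _ _ (mu * \sum_(x <- box m N.+1) D t x)); last first.
  by rewrite ler_pM2l// DM.
rewrite sum_box exchange_big mulr_sumr/=.
rewrite (@big_cat_nat _ _ _ k.+2 1 N.+2)//= (big_add1 _ _ k.+1) (big_add1 _ _ k)/=.
rewrite -[leLHS]add0r lerD//.
  by apply: sumr_ge0 => n _; rewrite mulr_ge0 ?(ltW mu_gt0)// sumr_ge0// => ? _; exact: normr_ge0.
apply: ler_sum_nat => n /andP[-> _].
by rewrite /c mulrCA [_^-1 * _]mulrA mulVf ?mul1r.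
Qed.

End FluidTrajectories.

Unset Implicit Arguments.

Theorem theorem3 (R : realType) (m : nat)
    (u : 'I_m.+1 -> R -> R) (lambda mu : R) (alpha : 'I_m.+1 -> R)
    (u_concave : forall i, concave_on `[0, +oo[ (u i))
    (lambda_gt0 : 0 < lambda) (mu_gt0 : 0 < mu)
    (alpha_itv : forall i, 0 < alpha i < 1)
    (alpha_sum : \sum_(i < m.+1) alpha i = 1)
    (q0 : state_index m -> R) (q0_Q : Qset alpha q0)
    (q q' : R -> state_index m -> R)
    (q_fluid : fluid_trajectory u lambda mu alpha q) (q_init : q 0 = q0)
    (q'_fluid : fluid_trajectory u lambda mu alpha q') (q'_init : q' 0 = q0) :
  forall t : R, 0 <= t -> q t = q' t.
Proof.
have alpha_gt0 i : 0 < alpha i by case/andP: (alpha_itv i).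
by apply: (fluid_trajectory_unique u_concave lambda_gt0 mu_gt0 alpha_gt0) => //; rewrite q_init.
Qed.
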